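(* Consider the higher order Camassa–Holm equation for a scalar function $u(x,t)$ of two real variables, $$\Delta := u_t-u_{xxt}+u_{xxxxt}+3uu_x-2u_xu_{xx}-uu_{xxx}+2u_xu_{xxxx}+uu_{xxxxx}=0 .$$ A smooth vector field $\mathbf v=\xi(x,t,u)\partial_x+\eta(x,t,u)\partial_t+\varphi(x,t,u)\partial_u$ is an infinitesimal (Lie point) symmetry of this equation if and only if there are real constants $c_1,c_2,c_3$ such that $$\xi=c_3,\qquad \eta=c_1t+c_2,\qquad \varphi=-c_1u .$$ Consequently the Lie algebra of infinitesimal symmetries of the equation is spanned by the three vector fields $$\mathbf v_1=\partial_x,\qquad \mathbf v_2=\partial_t,\qquad \mathbf v_3=t\,\partial_t-u\,\partial_u .$$
   Context: The independent variables are $x,t$ and the dependent variable is $u$; the coefficients $\xi,\eta,\varphi$ are smooth real functions of $(x,t,u)\in\mathbb R^3$. The partial derivatives of $u$ are treated as independent coordinates on the jet space, and for a multi-index $J$ in the letters $x,t$, $u_J$ denotes the corresponding derivative. $D_x,D_t$ are the total derivatives, e.g. $D_x=\partial_x+u_x\partial_u+\sum_J u_{J,x}\partial_{u_J}$, and $D_J$ is the corresponding composition. The fifth prolongation of $\mathbf v$ is $$\mathrm{Pr}^{(5)}\mathbf v=\mathbf v+\sum_{0<\#J\le 5}\varphi^J\,\partial_{u_J},\qquad \varphi^J=D_J(\varphi-\xi u_x-\eta u_t)+\xi u_{J,x}+\eta u_{J,t}.$$ The vector field $\mathbf v$ is an infinitesimal symmetry of the equation $\Delta=0$ if $\mathrm{Pr}^{(5)}\mathbf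 v[\Delta]=0$ at every point of the fifth-order jet space at which $\Delta=0$. *)

(* Defs.v *)
From Stdlib Require Import Reals Arith.
From Coquelicot Require Import Coquelicot.
Open Scope R_scope.

(** ** Smooth functions and vector fields on the space R^3 of (x, t, u) *)

Inductive bvar := bx | bt | bu.

Definition slice (a : bvar) (f : R -> R -> R -> R) (x t u : R) : R -> R :=
  match a with
  | bx => fun s => f s t u
  | bt => fun s => f x s u
  | bu => fun s => f x t s
  end.

Definition bval (a : bvar) (x t u : R) : R :=
  match a with bx => x | bt => t | bu => u end.

Definition ex_partial (a : bvar) (f : R -> R -> R -> R) (x t u : R) : Prop :=
  ex_derive (slice a f x t u) (bval a x t u).

Definition partial (a : bvar) (f : R -> R -> R -> R) (x t u : R) : R :=
  Derive (slice a f x t u) (bval a x t u).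

Definition continuous3 (f : R -> R -> R -> R) : Prop :=
  forall p : R * R * R,
    continuous (fun q : R * R * R => f (fst (fst q)) (snd (fst q)) (snd q)) p.

Fixpoint Ck (n : nat) (f : R -> R -> R -> R) : Prop :=
  continuous3 f /\
  match n with
  | O => True
  | S m => forall a : bvar,
      (forall x t u, ex_partial a f x t u) /\ Ck m (partial a f)
  end.

Definition smooth (f : R -> R -> R -> R) : Prop := forall n, Ck n f.

Record vfield := VField {
  xi  : R -> R -> R -> R;
  eta : R -> R -> R -> R;
  phi : R -> R -> R -> R }.

Definition smooth_vfield (v : vfield) : Prop :=
  smooth (xi v) /\ smooth (eta v) /\ smooth (phi v).

Definition vzero : vfield :=
  VField (fun _ _ _ => 0) (fun _ _ _ => 0) (fun _ _ _ => 0).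

Definition vadd (v w : vfield) : vfield :=
  VField (fun x t u => xi v x t u + xi w x t u)
         (fun x t u => eta v x t u + eta w x t u)
         (fun x t u => phi v x t u + phi w x t u).

Definition vscal (c : R) (v : vfield) : vfield :=
  VField (fun x t u => c * xi v x t u)
         (fun x t u => c * eta v x t u)
         (fun x t u => c * phi v x t u).

Definition vapply (v : vfield) (f : R -> R -> R -> R) (x t u : R) : R :=
  xi v x t u * partial bx f x t u + eta v x t u * partial bt f x t u
  + phi v x t u * partial bu f x t u.

Definition bracket (v w : vfield) : vfield :=
  VField (fun x t u => vapply v (xi w) x t u - vapply w (xi v) x t u)
         (fun x t u => vapply v (eta w) x t u - vapply w (eta v) x t u)
         (fun x t u => vapply v (phi w) x t u - vapply w (phi v) x t u).

Definition lie_subalgebra (S : vfield -> Prop) : Prop :=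
  S vzero /\
  (forall v w, S v -> S w -> S (vadd v w)) /\
  (forall c v, S v -> S (vscal c v)) /\
  (forall v w, S v -> S w -> S (bracket v w)).

(** ** Jets, total derivatives and prolongation *)

(** [cu i j] is the coordinate u_J, where J consists of i letters x and
    j letters t; in particular [cu 0 0] is u itself.  A [jet] assigns values to
    the coordinates of every order, so that total derivatives, which raise the
    order by one, act on a single type of functions; a function on the n-th
    order jet space is one that only reads the [cu i j] with i + j <= n. *)
Inductive coord := cx | ct | cu (i j : nat).

Definition coord_eq_dec (a b : coord) : {a = b} + {a <> b}.
Proof. decide equality; apply Nat.eq_dec. Defined.

Definition jet := coord -> R.

Definition jupd (z : jet) (a : coord) (s : R) : jet :=
  fun b => if coord_eq_dec a b then s else z b.

Definition jpartial (a : coord) (F : jet -> R) (z : jet) : R :=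
  Derive (fun s => F (jupd z a s)) (z a).

Definition lift (f : R -> R -> R -> R) (z : jet) : R :=
  f (z cx) (z ct) (z (cu 0 0)).

(** Sum of [a i j] over all multi-indices with i + j <= n. *)
Definition sum_upto (n : nat) (a : nat -> nat -> R) : R :=
  sum_n (fun k => sum_n (fun i => a i (k - i)%nat) k) n.

(** Total derivatives of functions F of order at most n: the remaining terms of
    the sum over all J vanish because F does not depend on u_J for #J > n. *)
Definition Dx (n : nat) (F : jet -> R) (z : jet) : R :=
  jpartial cx F z
  + sum_upto n (fun i j => z (cu (S i) j) * jpartial (cu i j) F z).

Definition Dt (n : nat) (F : jet -> R) (z : jet) : R :=
  jpartial ct F z
  + sum_upto n (fun i j => z (cu i (S j)) * jpartial (cu i j) F z).

Definition DJ (n i j : nat) (F : jet -> R) : jet -> R :=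
  Nat.iter i (Dx n) (Nat.iter j (Dt n) F).

Definition characteristic (v : vfield) (z : jet) : R :=
  lift (phi v) z - lift (xi v) z * z (cu 1 0) - lift (eta v) z * z (cu 0 1).

(** The characteristic has order 1, so for 0 < i + j <= n the i + j successive
    total derivatives are applied to functions of order at most n, as [DJ n]
    requires. *)
Definition phiJ (n : nat) (v : vfield) (i j : nat) (z : jet) : R :=
  DJ n i j (characteristic v) z
  + lift (xi v) z * z (cu (S i) j) + lift (eta v) z * z (cu i (S j)).

Definition prolong (n : nat) (v : vfield) (F : jet -> R) (z : jet) : R :=
  lift (xi v) z * jpartial cx F z + lift (eta v) z * jpartial ct F z
  + lift (phi v) z * jpartial (cu 0 0) F z
  + sum_upto n (fun i j =>
      if (i + j =? 0)%nat then 0 else phiJ n v i j z * jpartial (cu i j) F z).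

(** For [Delta] of order n. The terms of order n + 1 in [phiJ] cancel, so both
    sides of the implication only involve the n-th order part of the jet [z]. *)
Definition infinitesimal_symmetry (n : nat) (Delta : jet -> R) (v : vfield)
  : Prop := forall z : jet, Delta z = 0 -> prolong n v Delta z = 0.

Definition symmetry_algebra (n : nat) (Delta : jet -> R) (v : vfield) : Prop :=
  smooth_vfield v /\ infinitesimal_symmetry n Delta v.

(** ** The higher order Camassa-Holm equation *)

Definition HCH (z : jet) : R :=
  z (cu 0 1) - z (cu 2 1) + z (cu 4 1) + 3 * z (cu 0 0) * z (cu 1 0)
  - 2 * z (cu 1 0) * z (cu 2 0) - z (cu 0 0) * z (cu 3 0)
  + 2 * z (cu 1 0) * z (cu 4 0) + z (cu 0 0) * z (cu 5 0).

Definition v1 : vfield :=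
  VField (fun _ _ _ => 1) (fun _ _ _ => 0) (fun _ _ _ => 0).
Definition v2 : vfield :=
  VField (fun _ _ _ => 0) (fun _ _ _ => 1) (fun _ _ _ => 0).
Definition v3 : vfield :=
  VField (fun _ _ _ => 0) (fun _ t _ => t) (fun _ _ u => - u).

(* Main.v *)
Require Import Defs.
From Stdlib Require Import Reals Lia Lra List Arith FunctionalExtensionality.
From Coquelicot Require Import Coquelicot.
Import ListNotations.
Open Scope R_scope.

(** The prolonged equation is a polynomial in the jet coordinates whose coefficients
    are iterated partial derivatives of xi, eta, phi.  Such polynomials are represented
    by syntax trees, on which total derivatives and prolongation are computable.
    Solving the equation for u_xxxxt makes the remaining jet coordinates free, so every
    coefficient of the prolonged equation vanishes on the symmetries.  In order, the
    coefficients of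
    u_xxxtt, u_x u_xxxtt give eta_x = eta_u = 0;
    u_t u_xxxxx, u_xxxxx give xi_u = 0 and phi = xi_t + u (xi_x - eta_t);
    u_xxxt, u_t give xi_xx = 0 and xi_x = 0;
    u_x, u_xxxx give xi_t = 0 and eta_tt = 0.
    Conversely, for the fields so obtained the prolonged equation is -2 c1 times the
    equation. *)

(** * Differential polynomials *)

(** [Sym f l] stands for the iterated partial derivative of the [f]-th unknown function
    along [l], the head of [l] being the variable of the last derivation. *)
Inductive expr :=
| Zero | One
| Var (a : coord)
| Sym (f : nat) (l : list bvar)
| Add (e1 e2 : expr)
| Opp (e : expr)
| Mul (e1 e2 : expr).

Definition sadd (e1 e2 : expr) : expr :=
  match e1, e2 with Zero, _ => e2 | _, Zero => e1 | _, _ => Add e1 e2 end.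

Definition sopp (e : expr) : expr := match e with Zero => Zero | _ => Opp e end.

Definition smul (e1 e2 : expr) : expr :=
  match e1, e2 with
  | Zero, _ => Zero | _, Zero => Zero
  | One, _ => e2 | _, One => e1
  | _, _ => Mul e1 e2
  end.

Inductive dir := dx | dt.
Definition shift (d : dir) (i j : nat) : coord :=
  match d with dx => cu (S i) j | dt => cu i (S j) end.
Definition base (d : dir) : coord := match d with dx => cx | dt => ct end.
Definition bvar_of (d : dir) : bvar := match d with dx => bx | dt => bt end.
Definition Dtot (d : dir) : nat -> (jet -> R) -> jet -> R :=
  match d with dx => Defs.Dx | dt => Defs.Dt end.

Local Arguments coord_eq_dec : simpl never.

Fixpoint fpartial (a : coord) (e : expr) : expr :=
  match e with
  | Zero | One => Zero
  | Var b => if coord_eq_dec a b then One else Zero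
  | Sym f l =>
      match a with
      | cx => Sym f (bx :: l)
      | ct => Sym f (bt :: l)
      | cu 0 0 => Sym f (bu :: l)
      | _ => Zero
      end
  | Add e1 e2 => sadd (fpartial a e1) (fpartial a e2)
  | Opp e1 => sopp (fpartial a e1)
  | Mul e1 e2 => sadd (smul (fpartial a e1) e2) (smul e1 (fpartial a e2))
  end.

Fixpoint fD (d : dir) (e : expr) : expr :=
  match e with
  | Zero | One => Zero
  | Var (cu i j) => Var (shift d i j)
  | Var b => if coord_eq_dec (base d) b then One else Zero
  | Sym f l => Add (Sym f (bvar_of d :: l)) (Mul (Var (shift d 0 0)) (Sym f (bu :: l)))
  | Add e1 e2 => sadd (fD d e1) (fD d e2)
  | Opp e1 => sopp (fD d e1)
  | Mul e1 e2 => sadd (smul (fD d e1) e2) (smul e1 (fD d e2))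
  end.

Fixpoint order (e : expr) : nat :=
  match e with
  | Var (cu i j) => i + j
  | Add e1 e2 | Mul e1 e2 => Nat.max (order e1) (order e2)
  | Opp e1 => order e1
  | _ => 0
  end.

Definition bvar_eq_dec (a b : bvar) : {a = b} + {a <> b}.
Proof. decide equality. Defined.

(** [ds f] lists variables on which the [f]-th symbol does not depend, so that its
    derivatives along them can be dropped. *)
Fixpoint subst (ds : nat -> list bvar) (s : coord -> expr) (e : expr) : expr :=
  match e with
  | Zero => Zero | One => One
  | Var a => s a
  | Sym f l => if existsb (fun b => if in_dec bvar_eq_dec b l then true else false) (ds f)
               then Zero else Sym f l
  | Add e1 e2 => sadd (subst ds s e1) (subst ds s e2)
  | Opp e1 => sopp (subst ds s e1)
  | Mul e1 e2 => smul (subst ds s e1) (subst ds s e2)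
  end.

Fixpoint fsum (a : nat -> expr) (n : nat) : expr :=
  match n with O => a O | S m => sadd (fsum a m) (a (S m)) end.

Definition fsum_upto (n : nat) (a : nat -> nat -> expr) : expr :=
  fsum (fun k => fsum (fun i => a i (k - i)%nat) k) n.

Record fvfield := FVField { fxi : expr; feta : expr; fphi : expr }.

Definition fchar (w : fvfield) : expr :=
  Add (Add (fphi w) (Opp (Mul (fxi w) (Var (cu 1 0)))))
      (Opp (Mul (feta w) (Var (cu 0 1)))).

Definition fDJ (i j : nat) (e : expr) : expr :=
  Nat.iter i (fD dx) (Nat.iter j (fD dt) e).

Definition fphiJ (w : fvfield) (i j : nat) : expr :=
  Add (Add (fDJ i j (fchar w)) (Mul (fxi w) (Var (cu (S i) j))))
      (Mul (feta w) (Var (cu i (S j)))).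

Definition fprolong (n : nat) (w : fvfield) (F : expr) : expr :=
  sadd (sadd (sadd (smul (fxi w) (fpartial cx F)) (smul (feta w) (fpartial ct F)))
             (smul (fphi w) (fpartial (cu 0 0) F)))
       (fsum_upto n (fun i j =>
          if (i + j =? 0)%nat then Zero else smul (fphiJ w i j) (fpartial (cu i j) F))).

(** * Independence of a variable *)

Definition indep (b : bvar) (f : R -> R -> R -> R) : Prop :=
  forall x t u s s', slice b f x t u s = slice b f x t u s'.

Lemma indep_partial_0 b f x t u : indep b f -> partial b f x t u = 0.
Proof.
  intros H. unfold partial.
  rewrite (Derive_ext _ (fun _ => slice b f x t u 0)) by (intros; apply H).
  apply Derive_const.
Qed.

Lemma indep_partial b a f : indep b f -> indep b (partial a f).
Proof.
  intros H x t u s s'.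
  destruct (bvar_eq_dec a b) as [->|n].
  - destruct b; simpl; now rewrite !indep_partial_0.
  - destruct a, b; try easy; simpl; unfold partial; apply Derive_ext; intros r; simpl.
    + apply (H r t u).
    + apply (H r t u).
    + apply (H x r u).
    + apply (H x r u).
    + apply (H x t r).
    + apply (H x t r).
Qed.

Lemma indep_fold_partial b f l : indep b f -> indep b (fold_right partial f l).
Proof. intros H; induction l; simpl; auto using indep_partial. Qed.

Lemma fold_partial_0 b f l z : indep b f -> In b l ->
  lift (fold_right partial f l) z = 0.
Proof.
  intros H Hb. unfold lift. generalize (z cx), (z ct), (z (cu 0 0)).
  induction l as [|a l IH]; [easy|]. intros x t u; simpl.
  destruct Hb as [->|Hb].
  - now apply indep_partial_0, indep_fold_partial.
  - unfold partial. rewrite (Derive_ext _ (fun _ => 0)); [apply Derive_const|].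
    intros r. destruct a; apply IH; assumption.
Qed.

(** * Semantics *)

Section Eval.

Variable env : nat -> R -> R -> R -> R.

Definition val (f : nat) (l : list bvar) : R -> R -> R -> R :=
  fold_right partial (env f) l.

Fixpoint eval (e : expr) (z : jet) : R :=
  match e with
  | Zero => 0 | One => 1
  | Var a => z a
  | Sym f l => lift (val f l) z
  | Add e1 e2 => eval e1 z + eval e2 z
  | Opp e1 => - eval e1 z
  | Mul e1 e2 => eval e1 z * eval e2 z
  end.

Lemma eval_sadd e1 e2 z : eval (sadd e1 e2) z = eval e1 z + eval e2 z.
Proof. destruct e1, e2; simpl; ring. Qed.

Lemma eval_sopp e z : eval (sopp e) z = - eval e z.
Proof. destruct e; simpl; ring. Qed.

Lemma eval_smul e1 e2 z : eval (smul e1 e2) z = eval e1 z * eval e2 z.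
Proof. destruct e1, e2; simpl; ring. Qed.

Lemma jupd_same (z : jet) (a : coord) : jupd z a (z a) = z.
Proof.
  apply functional_extensionality; intro b; unfold jupd.
  destruct (coord_eq_dec a b); congruence.
Qed.

Lemma smooth_partial (a : bvar) (f : R -> R -> R -> R) :
  smooth f -> smooth (partial a f).
Proof. intros H n; destruct (H (S n)) as [_ K]; apply (K a). Qed.

Lemma smooth_ex_partial (a : bvar) (f : R -> R -> R -> R) (x t u : R) :
  smooth f -> ex_partial a f x t u.
Proof. intros H; destruct (H 1%nat) as [_ K]; apply (K a). Qed.

Hypothesis env_smooth : forall f, smooth (env f).

Lemma smooth_val f l : smooth (val f l).
Proof. induction l; simpl; auto using smooth_partial. Qed.

Lemma is_derive_eval (e : expr) (a : coord) (z : jet) :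
  is_derive (fun s => eval e (jupd z a s)) (z a) (eval (fpartial a e) z).
Proof.
  induction e; simpl.
  - apply @is_derive_const.
  - apply @is_derive_const.
  - unfold jupd. destruct (coord_eq_dec a a0) as [->|_]; simpl.
    + apply @is_derive_id.
    + apply @is_derive_const.
  - pose proof (smooth_val f l) as Hs. unfold lift.
    destruct a as [| |[|i] [|j]].
    + exact (Derive_correct _ _ (smooth_ex_partial bx _ (z cx) (z ct) (z (cu 0 0)) Hs)).
    + exact (Derive_correct _ _ (smooth_ex_partial bt _ (z cx) (z ct) (z (cu 0 0)) Hs)).
    + exact (Derive_correct _ _ (smooth_ex_partial bu _ (z cx) (z ct) (z (cu 0 0)) Hs)).
    + exact (is_derive_const (val f l (z cx) (z ct) (z (cu 0 0))) _).
    + exact (is_derive_const (val f l (z cx) (z ct) (z (cu 0 0))) _).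
    + exact (is_derive_const (val f l (z cx) (z ct) (z (cu 0 0))) _).
  - rewrite eval_sadd. apply @is_derive_plus; assumption.
  - rewrite eval_sopp. apply @is_derive_opp; assumption.
  - rewrite eval_sadd, !eval_smul.
    pose proof (is_derive_mult _ _ _ _ _ IHe1 IHe2 Rmult_comm) as K.
    cbv beta in K. rewrite jupd_same in K. exact K.
Qed.

Lemma jpartial_eval e a z : jpartial a (eval e) z = eval (fpartial a e) z.
Proof. apply is_derive_unique, is_derive_eval. Qed.

Lemma sum_n_indicator (a : nat -> R) (k0 n : nat) :
  sum_n (fun k => if Nat.eq_dec k k0 then a k else 0) n
  = if le_dec k0 n then a k0 else 0.
Proof.
  induction n as [|n IH].
  - rewrite sum_O. destruct (Nat.eq_dec 0 k0), (le_dec k0 0); subst; try lia; easy.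
  - rewrite sum_Sn, IH. change (@plus R_AbelianMonoid) with Rplus.
    destruct (Nat.eq_dec (S n) k0), (le_dec k0 n), (le_dec k0 (S n)); subst; try lia.
    all: lra.
Qed.

Lemma sum_upto_ext n a b :
  (forall i j, (i + j <= n)%nat -> a i j = b i j) -> sum_upto n a = sum_upto n b.
Proof.
  intros H. unfold sum_upto. apply sum_n_ext_loc; intros k Hk.
  apply sum_n_ext_loc; intros i Hi. apply H; lia.
Qed.

Lemma sum_upto_plus n a b :
  sum_upto n (fun i j => a i j + b i j) = sum_upto n a + sum_upto n b.
Proof.
  unfold sum_upto.
  rewrite (sum_n_ext _ (fun k => sum_n (fun i => a i (k - i)%nat) k
      + sum_n (fun i => b i (k - i)%nat) k))
    by (intros k; apply (sum_n_plus (G := R_AbelianMonoid))).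
  apply (sum_n_plus (G := R_AbelianMonoid)).
Qed.

Lemma sum_upto_scal n c a : sum_upto n (fun i j => c * a i j) = c * sum_upto n a.
Proof.
  unfold sum_upto.
  rewrite (sum_n_ext _ (fun k => c * sum_n (fun i => a i (k - i)%nat) k))
    by (intros k; apply (sum_n_mult_l (K := R_Ring))).
  apply (sum_n_mult_l (K := R_Ring)).
Qed.

Lemma sum_upto_0 n a : (forall i j, (i + j <= n)%nat -> a i j = 0) -> sum_upto n a = 0.
Proof.
  intros H. rewrite (sum_upto_ext n a (fun i j => 0 * a i j)).
  - rewrite sum_upto_scal; ring.
  - intros i j Hij; rewrite (H i j Hij); ring.
Qed.

Lemma sum_upto_single n a i0 j0 : (i0 + j0 <= n)%nat ->
  (forall i j, (i, j) <> (i0, j0) -> a i j = 0) -> sum_upto n a = a i0 j0.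
Proof.
  intros Hn H. unfold sum_upto.
  rewrite (sum_n_ext _ (fun k => if Nat.eq_dec k (i0 + j0) then a i0 j0 else 0)).
  - rewrite (sum_n_indicator (fun _ => a i0 j0)). destruct le_dec; [easy|lia].
  - intros k.
    transitivity (sum_n (fun i => if Nat.eq_dec i i0 then
       (if Nat.eq_dec k (i0 + j0) then a i0 j0 else 0) else 0) k).
    + apply sum_n_ext_loc; intros i Hi.
      destruct (Nat.eq_dec i i0) as [->|Hi0], (Nat.eq_dec k (i0 + j0)) as [->|Hk].
      * f_equal; lia.
      * apply H; intros E; injection E; lia.
      * apply H; congruence.
      * apply H; congruence.
    + rewrite (sum_n_indicator (fun _ => if Nat.eq_dec k (i0 + j0) then a i0 j0 else 0)).
      destruct le_dec, (Nat.eq_dec k (i0 + j0)); easy || lia.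
Qed.

Lemma Dtot_eval d n e z : (order e <= n)%nat ->
  Dtot d n (eval e) z = eval (fD d e) z.
Proof.
  intros Ho.
  assert (HD : Dtot d n (eval e) z = eval (fpartial (base d) e) z
     + sum_upto n (fun i j => z (shift d i j) * eval (fpartial (cu i j) e) z)).
  { destruct d; simpl; unfold Defs.Dx, Defs.Dt; rewrite jpartial_eval; f_equal;
      apply sum_upto_ext; intros; rewrite jpartial_eval; reflexivity. }
  rewrite HD; clear HD.
  induction e; simpl in *.
  - rewrite sum_upto_0; intros; ring.
  - rewrite sum_upto_0; intros; ring.
  - destruct a as [| |i0 j0].
    + rewrite sum_upto_0; [destruct d; simpl; ring|].
      intros; destruct coord_eq_dec; [discriminate|simpl; ring].
    + rewrite sum_upto_0; [destruct d; simpl; ring|].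
      intros; destruct coord_eq_dec; [discriminate|simpl; ring].
    + rewrite (sum_upto_single n _ i0 j0 Ho).
      * destruct (coord_eq_dec (cu i0 j0) (cu i0 j0)); [|easy].
        destruct (coord_eq_dec (base d) (cu i0 j0)); [destruct d; discriminate|].
        simpl; ring.
      * intros i j Hij. destruct (coord_eq_dec (cu i j) (cu i0 j0)); [congruence|simpl; ring].
  - rewrite (sum_upto_single n _ 0 0); [|lia|].
    + destruct d; simpl; ring.
    + intros [|i] [|j] Hij; simpl; try congruence; ring.
  - rewrite !eval_sadd, <- IHe1, <- IHe2 by lia.
    rewrite (sum_upto_ext _ _ (fun i j => z (shift d i j) * eval (fpartial (cu i j) e1) z
      + z (shift d i j) * eval (fpartial (cu i j) e2) z))
      by (intros; rewrite eval_sadd; ring).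
    rewrite sum_upto_plus; ring.
  - rewrite !eval_sopp, <- IHe by lia.
    rewrite (sum_upto_ext _ _ (fun i j => -1 * (z (shift d i j) * eval (fpartial (cu i j) e) z)))
      by (intros; rewrite eval_sopp; ring).
    rewrite sum_upto_scal; ring.
  - rewrite !eval_sadd, !eval_smul, <- IHe1, <- IHe2 by lia.
    rewrite (sum_upto_ext _ _ (fun i j =>
      eval e2 z * (z (shift d i j) * eval (fpartial (cu i j) e1) z)
      + eval e1 z * (z (shift d i j) * eval (fpartial (cu i j) e2) z)))
      by (intros; rewrite eval_sadd, !eval_smul; ring).
    rewrite sum_upto_plus, !sum_upto_scal; ring.
Qed.

Lemma order_sadd e1 e2 : (order (sadd e1 e2) <= Nat.max (order e1) (order e2))%nat.
Proof. destruct e1, e2; simpl; lia. Qed.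

Lemma order_smul e1 e2 : (order (smul e1 e2) <= Nat.max (order e1) (order e2))%nat.
Proof. destruct e1, e2; simpl; lia. Qed.

Lemma order_sopp e : (order (sopp e) <= order e)%nat.
Proof. destruct e; simpl; lia. Qed.

Lemma order_fD d e : (order (fD d e) <= S (order e))%nat.
Proof.
  induction e; simpl; try lia.
  - destruct a; try (destruct coord_eq_dec; simpl; lia). destruct d; simpl; lia.
  - destruct d; simpl; lia.
  - pose proof (order_sadd (fD d e1) (fD d e2)); lia.
  - pose proof (order_sopp (fD d e)); lia.
  - pose proof (order_sadd (smul (fD d e1) e2) (smul e1 (fD d e2))).
    pose proof (order_smul (fD d e1) e2). pose proof (order_smul e1 (fD d e2)). lia.
Qed.

Lemma iter_Dtot_eval d n m e : (order e + m <= S n)%nat ->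
  Nat.iter m (Dtot d n) (eval e) = eval (Nat.iter m (fD d) e) /\
  (order (Nat.iter m (fD d) e) <= order e + m)%nat.
Proof.
  induction m as [|m IH]; intros H; simpl.
  - split; [easy|lia].
  - destruct IH as [IH1 IH2]; [lia|]. split.
    + rewrite IH1. apply functional_extensionality; intro z.
      apply Dtot_eval; lia.
    + pose proof (order_fD d (Nat.iter m (fD d) e)); lia.
Qed.

Lemma DJ_eval n i j e : (order e + i + j <= S n)%nat ->
  DJ n i j (eval e) = eval (fDJ i j e).
Proof.
  intros H. unfold DJ, fDJ.
  destruct (iter_Dtot_eval dt n j e) as [H1 H2]; [lia|]. simpl in H1. rewrite H1.
  destruct (iter_Dtot_eval dx n i (Nat.iter j (fD dt) e)) as [H3 _]; [lia|].
  exact H3.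
Qed.

Definition represents (w : fvfield) (v : vfield) : Prop :=
  (order (fchar w) <= 1)%nat /\
  forall z, lift (xi v) z = eval (fxi w) z /\
            lift (eta v) z = eval (feta w) z /\
            lift (phi v) z = eval (fphi w) z.

Lemma phiJ_eval n w v i j z : represents w v -> (i + j <= n)%nat ->
  phiJ n v i j z = eval (fphiJ w i j) z.
Proof.
  intros [Ho H] Hij. unfold phiJ, fphiJ.
  replace (characteristic v) with (eval (fchar w)).
  - rewrite DJ_eval by lia. destruct (H z) as (-> & -> & _). reflexivity.
  - apply functional_extensionality; intro y. unfold characteristic.
    destruct (H y) as (-> & -> & ->). simpl; ring.
Qed.

Lemma eval_fsum a n z : eval (fsum a n) z = sum_n (fun k => eval (a k) z) n.
Proof.
  induction n; simpl; [now rewrite sum_O|].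
  rewrite eval_sadd, IHn, sum_Sn. reflexivity.
Qed.

Lemma prolong_eval n w v F z : represents w v ->
  prolong n v (eval F) z = eval (fprolong n w F) z.
Proof.
  intros Hw. destruct (proj2 Hw z) as (Hx & Ht & Hu).
  unfold prolong, fprolong, fsum_upto.
  rewrite !eval_sadd, !eval_smul, !jpartial_eval, Hx, Ht, Hu. f_equal.
  rewrite eval_fsum.
  rewrite (sum_n_ext _ (fun k => sum_n (fun i => eval
     (if (i + (k - i) =? 0)%nat then Zero
      else smul (fphiJ w i (k - i)) (fpartial (cu i (k - i)) F)) z) k))
    by (intros; apply eval_fsum).
  apply (sum_upto_ext n _ (fun i j => eval (if (i + j =? 0)%nat then Zero
      else smul (fphiJ w i j) (fpartial (cu i j) F)) z)).
  intros i j Hij. destruct (i + j =? 0)%nat; [reflexivity|].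
  rewrite eval_smul, jpartial_eval, (phiJ_eval n w) by easy. reflexivity.
Qed.

Lemma eval_subst ds s e z y :
  (forall f b, In b (ds f) -> indep b (env f)) ->
  (forall a, eval (s a) z = y a) -> y cx = z cx -> y ct = z ct -> y (cu 0 0) = z (cu 0 0) ->
  eval (subst ds s e) z = eval e y.
Proof.
  intros Hd Hs Hx Ht Hu. induction e; simpl.
  - easy.
  - easy.
  - apply Hs.
  - replace (lift (val f l) y) with (lift (val f l) z)
      by (unfold lift; now rewrite Hx, Ht, Hu).
    destruct (existsb _ _) eqn:E; [|easy].
    apply existsb_exists in E as (b & Hb & Hl).
    destruct in_dec as [Hin|]; [|easy].
    symmetry; apply (fold_partial_0 b); auto.
  - rewrite eval_sadd. congruence.
  - rewrite eval_sopp. congruence.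
  - rewrite eval_smul. congruence.
Qed.

End Eval.

(** * Determining equations *)

Definition U (i j : nat) : expr := Var (cu i j).

Definition frest : expr :=
  let two := Add One One in
  let three := Add two One in
  Add (Add (Add (Add (Add (Add (U 0 1) (Opp (U 2 1)))
    (Mul (Mul three (U 0 0)) (U 1 0)))
    (Opp (Mul (Mul two (U 1 0)) (U 2 0))))
    (Opp (Mul (U 0 0) (U 3 0))))
    (Mul (Mul two (U 1 0)) (U 4 0)))
    (Mul (U 0 0) (U 5 0)).

Definition fHCH : expr := Add frest (U 4 1).

Lemma eval_fHCH env : eval env fHCH = HCH.
Proof. apply functional_extensionality; intro z. unfold HCH; simpl; ring. Qed.

Definition solve_top (a : coord) : expr :=
  if coord_eq_dec (cu 4 1) a then Opp frest else Var a.

Definition fiber (a : coord) : expr :=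
  match a with cu 0 0 | cx | ct => Var a | _ => Zero end.

Definition jet0 (x t u : R) : jet :=
  fun a => match a with cx => x | ct => t | cu 0 0 => u | _ => 0 end.

(** For a monomial [m] in the derivatives of u, a factorial multiple of its coefficient
    in the prolonged equation after elimination of u_xxxxt. *)
Definition coef (ds : nat -> list bvar) (w : fvfield) (m : list coord) : expr :=
  subst ds fiber (fold_right fpartial
    (subst (fun _ => []) solve_top (fprolong 5 w fHCH)) m).

Lemma symmetry_coef env w v ds m x t u :
  (forall f, smooth (env f)) -> represents env w v ->
  (forall f b, In b (ds f) -> indep b (env f)) ->
  infinitesimal_symmetry 5 HCH v ->
  eval env (coef ds w m) (jet0 x t u) = 0.
Proof.
  intros He Hw Hd Hs.
  set (P := subst (fun _ => []) solve_top (fprolong 5 w fHCH)).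
  assert (HP : forall z, eval env P z = 0).
  { intros z.
    set (y := jupd z (cu 4 1) (- eval env frest z)).
    transitivity (eval env (fprolong 5 w fHCH) y).
    - apply eval_subst; try reflexivity; [easy|].
      intros a. unfold solve_top, y, jupd. destruct coord_eq_dec; reflexivity.
    - rewrite <- (prolong_eval env He 5 w v fHCH y Hw), eval_fHCH.
      apply Hs. rewrite <- (eval_fHCH env). simpl. unfold y, jupd; simpl. ring. }
  assert (Hm : forall z, eval env (fold_right fpartial P m) z = 0).
  { induction m as [|a m IH]; [exact HP|]. intros z. simpl.
    rewrite <- jpartial_eval by easy. unfold jpartial.
    rewrite (Derive_ext _ (fun _ => 0)) by (intros; apply IH). apply Derive_const. }
  unfold coef. fold P.
  rewrite (eval_subst env ds fiber _ _ (jet0 x t u)); auto.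
  intros [| |[|i] [|j]]; reflexivity.
Qed.

Ltac determining env v ds w m K :=
  let e := eval vm_compute in (coef ds w m) in
  assert (K : forall x t u, eval env e (jet0 x t u) = 0);
  [ intros x t u; replace e with (coef ds w m) by (vm_compute; reflexivity);
    apply (symmetry_coef env w v); assumption
  | simpl in K; unfold lift, val in K; simpl in K ].

Lemma indep_of_partial (b : bvar) (f : R -> R -> R -> R) :
  smooth f -> (forall x t u, partial b f x t u = 0) -> indep b f.
Proof.
  intros Hf H x t u.
  assert (Hd : forall s, is_derive (slice b f x t u) s zero).
  { intros s.
    assert (E : exists x' t' u', slice b f x t u = slice b f x' t' u' /\ s = bval b x' t' u').
    { destruct b; [exists s, t, u|exists x, s, u|exists x, t, s]; split; reflexivity. }
    destruct E as (x' & t' & u' & -> & ->). change (@zero R_NormedModule) with 0.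
    rewrite <- (H x' t' u'). apply Derive_correct, smooth_ex_partial, Hf. }
  assert (L : forall s s', s < s' -> slice b f x t u s = slice b f x t u s').
  { intros s s' Hs. apply (eq_is_derive (slice b f x t u)); auto. }
  intros s s'. destruct (Rtotal_order s s') as [h|[->|h]]; auto. symmetry; auto.
Qed.

Lemma indep_all (f : R -> R -> R -> R) :
  indep bx f -> indep bt f -> indep bu f -> forall x t u, f x t u = f 0 0 0.
Proof.
  intros Hx Ht Hu x t u.
  transitivity (f x t 0); [exact (Hu x t 0 u 0)|].
  transitivity (f x 0 0); [exact (Ht x 0 0 t 0)|exact (Hx 0 0 0 x 0)].
Qed.

Definition fv_generic : fvfield := FVField (Sym 0 []) (Sym 1 []) (Sym 2 []).

Definition fv_reduced : fvfield :=
  FVField (Sym 0 []) (Sym 1 [])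
    (Add (Sym 0 [bt]) (Mul (U 0 0) (Add (Sym 0 [bx]) (Opp (Sym 1 [bt]))))).

Definition env_of (v : vfield) (n : nat) : R -> R -> R -> R :=
  match n with 0 => xi v | 1 => eta v | _ => phi v end.

Definition ds_of (lx le : list bvar) (n : nat) : list bvar :=
  match n with 0 => lx | 1 => le | _ => [] end.

Lemma symmetry_form (v : vfield) : smooth_vfield v -> infinitesimal_symmetry 5 HCH v ->
  exists c1 c2 c3 : R, forall x t u : R,
    xi v x t u = c3 /\ eta v x t u = c1 * t + c2 /\ phi v x t u = - c1 * u.
Proof.
  intros (Sx & Se & Sp) Hs.
  assert (He : forall f, smooth (env_of v f)) by (intros [|[|f]]; assumption).
  assert (Hw : represents (env_of v) fv_generic v).
  { split; [vm_compute; lia|]. intros z; repeat split. }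
  assert (Hd : forall f b, In b (ds_of [] [] f) -> indep b (env_of v f))
    by (intros [|[|f]]; easy).
  determining (env_of v) v (ds_of [] []) fv_generic [cu 3 2] Kx.
  determining (env_of v) v (ds_of [] []) fv_generic [cu 3 2; cu 1 0] Ku.
  assert (Iex : indep bx (eta v)).
  { apply indep_of_partial; [easy|]; intros x t u; specialize (Kx x t u); lra. }
  assert (Ieu : indep bu (eta v)).
  { apply indep_of_partial; [easy|]; intros x t u; specialize (Ku x t u); lra. }
  clear Kx Ku Hd.
  assert (Hd : forall f b, In b (ds_of [] [bx; bu] f) -> indep b (env_of v f)).
  { intros [|[|f]] b; simpl; [easy| |easy]. now intros [<-|[<-|[]]]. }
  determining (env_of v) v (ds_of [] [bx; bu]) fv_generic [cu 5 0; cu 0 1] Kx.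
  determining (env_of v) v (ds_of [] [bx; bu]) fv_generic [cu 5 0] Kp.
  assert (Ixu : indep bu (xi v)).
  { apply indep_of_partial; [easy|]; intros x t u; specialize (Kx x t u); lra. }
  assert (Hphi : forall x t u, phi v x t u = partial bt (xi v) x t u
            + u * (partial bx (xi v) x t u - partial bt (eta v) x t u)).
  { intros x t u. specialize (Kp x t u). lra. }
  clear Kx Kp Hd Hw.
  assert (Hw : represents (env_of v) fv_reduced v).
  { split; [vm_compute; lia|]. intros z; repeat split.
    simpl. unfold lift; rewrite Hphi; simpl; ring. }
  assert (Hd : forall f b, In b (ds_of [bu] [bx; bu] f) -> indep b (env_of v f)).
  { intros [|[|f]] b; simpl; [| |easy]; [now intros [<-|[]]|now intros [<-|[<-|[]]]]. }
  determining (env_of v) v (ds_of [bu] [bx; bu]) fv_reduced [cu 3 1] Kxx.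
  determining (env_of v) v (ds_of [bu] [bx; bu]) fv_reduced [cu 0 1] Kx.
  assert (Hxx : partial bx (partial bx (xi v)) = fun _ _ _ => 0).
  { do 3 (apply functional_extensionality; intro).
    match goal with |- partial _ _ ?x ?t ?u = _ => specialize (Kxx x t u) end. lra. }
  assert (H0 : partial bx (fun _ _ _ => 0) = fun _ _ _ => 0).
  { do 3 (apply functional_extensionality; intro). apply (Derive_const 0). }
  assert (Ixx : indep bx (xi v)).
  { apply indep_of_partial; [easy|]; intros x t u; specialize (Kx x t u).
    rewrite Hxx, !H0 in Kx. lra. }
  clear Kxx Kx Hd.
  assert (Hd : forall f b, In b (ds_of [bx; bu] [bx; bu] f) -> indep b (env_of v f)).
  { intros [|[|f]] b; simpl; [| |easy]; now intros [<-|[<-|[]]]. }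
  determining (env_of v) v (ds_of [bx; bu] [bx; bu]) fv_reduced [cu 1 0] Kt.
  determining (env_of v) v (ds_of [bx; bu] [bx; bu]) fv_reduced [cu 4 0] Ktt.
  assert (Ixt : indep bt (xi v)).
  { apply indep_of_partial; [easy|]; intros x t u; specialize (Kt x t u); lra. }
  assert (Iett : indep bt (partial bt (eta v))).
  { apply indep_of_partial; [now apply smooth_partial|]; intros x t u; specialize (Ktt x t u); lra. }
  pose proof (indep_all (xi v) Ixx Ixt Ixu) as Cx.
  pose proof (indep_all (partial bt (eta v)) (indep_partial _ bt _ Iex) Iett
    (indep_partial _ bt _ Ieu)) as Ce.
  set (c1 := partial bt (eta v) 0 0 0) in *.
  exists c1, (eta v 0 0 0), (xi v 0 0 0). intros x t u. split; [apply Cx|].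
  split.
  - assert (I : indep bt (fun x t u => eta v x t u - c1 * t)).
    { intros x0 t0 u0.
      assert (L : forall s s', s < s' -> eta v x0 s u0 - c1 * s = eta v x0 s' u0 - c1 * s').
      { intros s s' h. apply (eq_is_derive (fun s => eta v x0 s u0 - c1 * s)); [|easy].
        intros r _. change (@zero R_NormedModule) with 0. replace 0 with (c1 - c1 * 1) by ring.
        apply @is_derive_minus.
        - rewrite <- (Ce x0 r u0).
          exact (Derive_correct _ _ (smooth_ex_partial bt _ x0 r u0 Se)).
        - apply is_derive_scal, @is_derive_id. }
      intros s s'; simpl. destruct (Rtotal_order s s') as [h|[->|h]]; auto.
      symmetry; auto. }
    pose proof (I x 0 u t 0) as It. simpl in It.
    pose proof (Iex 0 0 u x 0 : eta v x 0 u = eta v 0 0 u) as Ix.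
    pose proof (Ieu 0 0 0 u 0 : eta v 0 0 u = eta v 0 0 0) as Iu. lra.
  - rewrite Hphi, Ce.
    assert (Zx : forall b, indep b (xi v) -> partial b (xi v) x t u = 0)
      by (intros b Hb; now apply indep_partial_0).
    rewrite !Zx by assumption. ring.
Qed.

(** * The symmetry algebra *)

Definition affine (a b c d x t u : R) : R := a * x + b * t + c * u + d.

Lemma partial_affine (e : bvar) (a b c d : R) :
  partial e (affine a b c d)
  = affine 0 0 0 (match e with bx => a | bt => b | bu => c end).
Proof.
  do 3 (apply functional_extensionality; intro).
  unfold partial, affine. apply is_derive_unique.
  destruct e; simpl; auto_derive; auto; ring.
Qed.

Lemma continuous3_affine (a b c d : R) : continuous3 (affine a b c d).
Proof.
  intros p. unfold affine.
  assert (Hplus : forall f g : R * R * R -> R, continuous f p -> continuous g p ->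
    continuous (fun q => f q + g q) p)
    by (intros f g; exact (continuous_plus (V := R_NormedModule) f g p)).
  assert (Hscal : forall k (f : R * R * R -> R), continuous f p ->
    continuous (fun q => k * f q) p)
    by (intros k f; exact (continuous_scal_r (V := R_NormedModule) k f p)).
  pose proof (continuous_fst (fst p) (snd p)) as Hf.
  apply (Hplus (fun q => a * fst (fst q) + b * snd (fst q) + c * snd q) (fun _ => d));
    [|apply continuous_const].
  apply (Hplus (fun q => a * fst (fst q) + b * snd (fst q)) (fun q => c * snd q));
    [|exact (Hscal c snd (continuous_snd (fst p) (snd p)))].
  apply (Hplus (fun q => a * fst (fst q)) (fun q => b * snd (fst q))).
  - exact (Hscal a _ (continuous_comp fst fst p Hf (continuous_fst _ _))).
  - exact (Hscal b _ (continuous_comp fst snd p Hf (continuous_snd _ _))).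
Qed.

Lemma smooth_affine (a b c d : R) : smooth (affine a b c d).
Proof.
  intros n; revert a b c d; induction n as [|n IH]; intros a b c d;
    (split; [apply continuous3_affine|]); [easy|].
  intros e. rewrite partial_affine. split; [|apply IH].
  intros x t u. unfold ex_partial, affine. destruct e; simpl; auto_derive; auto.
Qed.

Definition vaff (c1 c2 c3 : R) : vfield :=
  VField (affine 0 0 0 c3) (affine 0 c1 0 c2) (affine 0 0 (- c1) 0).

Lemma vaff_span (c1 c2 c3 : R) :
  vaff c1 c2 c3 = vadd (vadd (vscal c3 v1) (vscal c2 v2)) (vscal c1 v3).
Proof.
  unfold vaff, vadd, vscal, affine; simpl.
  f_equal; do 3 (apply functional_extensionality; intro); ring.
Qed.

Definition fv_affine : fvfield :=
  FVField (Sym 0 []) (Add (Mul (Sym 1 []) (Var ct)) (Sym 2 []))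
    (Opp (Mul (Sym 1 []) (U 0 0))).

Lemma vaff_prolong (c1 c2 c3 : R) (z : jet) :
  prolong 5 (vaff c1 c2 c3) HCH z = - 2 * c1 * HCH z.
Proof.
  set (env := fun n => affine 0 0 0 (match n with O => c3 | 1%nat => c1 | _ => c2 end)).
  assert (He : forall f, smooth (env f)) by (intros f; apply smooth_affine).
  assert (Hw : represents env fv_affine (vaff c1 c2 c3)).
  { split; [vm_compute; lia|]. intros y. unfold lift; simpl. unfold lift, env, affine; simpl.
    repeat split; ring. }
  rewrite <- (eval_fHCH env), (prolong_eval env He 5 _ _ _ _ Hw), eval_fHCH.
  rewrite <- (eval_subst env (fun _ => [bx; bt; bu]) Var _ z z); try easy.
  2: { intros f b _ x t u s s'. unfold env, affine. destruct b; simpl; ring. }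
  match goal with |- eval _ ?e z = _ =>
    let e' := eval vm_compute in e in replace e with e' by (vm_compute; reflexivity) end.
  unfold HCH; simpl. unfold lift, env, affine; simpl. ring.
Qed.

Lemma symmetry_algebra_vaff (v : vfield) :
  symmetry_algebra 5 HCH v <-> exists c1 c2 c3, v = vaff c1 c2 c3.
Proof.
  split.
  - intros [Sv Hv]. destruct (symmetry_form v Sv Hv) as (c1 & c2 & c3 & H).
    exists c1, c2, c3. destruct v as [f g h]; simpl in H.
    unfold vaff, affine; f_equal; do 3 (apply functional_extensionality; intro);
      match goal with |- _ ?x ?t ?u = _ => destruct (H x t u) as (? & ? & ?) end; lra.
  - intros (c1 & c2 & c3 & ->). split.
    + repeat split; apply smooth_affine.
    + intros z Hz. rewrite vaff_prolong, Hz. ring.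
Qed.

Theorem mainTheorem1 :
  (forall v : vfield, smooth_vfield v ->
     (infinitesimal_symmetry 5 HCH v <->
      exists c1 c2 c3 : R, forall x t u : R,
        xi v x t u = c3 /\ eta v x t u = c1 * t + c2 /\ phi v x t u = - c1 * u))
  /\
  (lie_subalgebra (symmetry_algebra 5 HCH) /\
   forall v : vfield,
     symmetry_algebra 5 HCH v <->
     exists a1 a2 a3 : R,
       v = vadd (vadd (vscal a1 v1) (vscal a2 v2)) (vscal a3 v3)).
Proof.
  split; [|split].
  - intros v Sv. split; [now apply symmetry_form|].
    intros (c1 & c2 & c3 & H).
    replace v with (vaff c1 c2 c3).
    + apply symmetry_algebra_vaff. now exists c1, c2, c3.
    + destruct v as [f g h]; simpl in H.
      unfold vaff, affine; f_equal; do 3 (apply functional_extensionality; intro);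
        match goal with |- _ = _ ?x ?t ?u => destruct (H x t u) as (? & ? & ?) end; lra.
  - split; [|split; [|split]].
    + apply symmetry_algebra_vaff. exists 0, 0, 0. unfold vzero, vaff, affine.
      f_equal; do 3 (apply functional_extensionality; intro); ring.
    + intros v w. rewrite !symmetry_algebra_vaff.
      intros (c1 & c2 & c3 & ->) (d1 & d2 & d3 & ->).
      exists (c1 + d1), (c2 + d2), (c3 + d3). unfold vadd, vaff, affine; simpl.
      f_equal; do 3 (apply functional_extensionality; intro); ring.
    + intros c v. rewrite !symmetry_algebra_vaff. intros (c1 & c2 & c3 & ->).
      exists (c * c1), (c * c2), (c * c3). unfold vscal, vaff, affine; simpl.
      f_equal; do 3 (apply functional_extensionality; intro); ring.
    + intros v w. rewrite !symmetry_algebra_vaff.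
      intros (c1 & c2 & c3 & ->) (d1 & d2 & d3 & ->).
      exists 0, (c2 * d1 - d2 * c1), 0. unfold bracket, vapply, vaff; simpl.
      rewrite !partial_affine. unfold affine.
      f_equal; do 3 (apply functional_extensionality; intro); ring.
  - intros v. rewrite symmetry_algebra_vaff. split.
    + intros (c1 & c2 & c3 & ->). exists c3, c2, c1. apply vaff_span.
    + intros (a1 & a2 & a3 & ->). exists a3, a2, a1. symmetry; apply vaff_span.
Qed.
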